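(* Let $T=(t_{ij})\in\mathbb{R}^{n\times n}$ be the transition matrix of an $n$-state ergodic homogeneous Markov chain with states $1,\ldots,n$. Let $G$ be the weighted digraph without loops whose vertices are $1,\ldots,n$ and whose arc weights are equal to the corresponding transition probabilities in $T$ (that is, for $i\neq j$, $(i,j)$ is an arc of $G$ if and only if $t_{ij}\neq 0$, and then its weight is $t_{ij}$). For states $i,j$, let $m_{ij}$ be the mean first passage time from state $i$ to state $j$. Then for all $i,j\in\{1,\ldots,n\}$, $$ m_{ij}= \begin{cases} f_{ij}/q_j, & \text{if } i\neq j,\\ 1/\tilde q_j, & \text{if } i=j, \end{cases} $$ where $f_{ij}$ (for $i\ne j$) is the total weight of the $2$-tree in-forests of $G$ that have one tree containing $i$ and the other tree converging to $j$, $q_j$ is the total weight of the spanning trees of $G$ converging to $j$, and $\tilde q_j=q_j/\sum_{k=1}^n q_k$.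
   Context: Markov chain conventions. $t_{ij}=\Pr(X_{p+1}=j\mid X_p=i)$, so $T$ is row-stochastic. The chain being ergodic means that $T$ is an irreducible stochastic matrix. The mean first passage time from state $i$ to state $j$ is $$m_{ij}=\mathrm{E}(F_{ij})=\sum_{k=1}^{\infty}k\,\Pr(F_{ij}=k),\qquad F_{ij}=\min\{p\ge 1: X_p=j \mid X_0=i\},$$ i.e. $F_{ij}$ is the first time $p\geq 1$ at which the chain started at $X_0=i$ is in state $j$ (so $m_{jj}$ is the mean return time to $j$). Graph conventions. A digraph is weakly connected if the corresponding undirected graph is connected; a weak component of a digraph is a maximal weakly connected subdigraph. A converging tree is a weakly connected digraph in which one vertex, called the root, has outdegree zero and all the remaining vertices have outdegree one (a single vertex with no arcs is a converging tree); it is said to converge to its root. An in-forest of $G$ is a spanning subgraph of $G$ (i.e. containing all vertices of $G$) all of whose weak components are converging trees. A $2$-tree in-forest is an in-forest with exactly two weak components. A spanning tree of $G$ converging to $j$ is an in-forest of $G$ with exactly one weak component, whose root is $j$. Weights. The weight of a weighted digraph is the product of the weights of its arcs; the weight of a digraph with no arcs is $1$. The total weight of a set of digraphs is the sum of the weights of its members (and is $0$ for the empty set). *)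

(* Defs.v *)
From HB Require Import structures.
From mathcomp Require Import all_boot all_order all_algebra.
From mathcomp Require Import all_classical all_reals all_analysis.

Set Implicit Arguments.
Unset Strict Implicit.
Unset Printing Implicit Defensive.

Import Order.TTheory GRing.Theory Num.Theory.

Local Open Scope ring_scope.

(* A digraph is a pair (vertex set, arc set) over an ambient finite type; the
   pair (x, y) is the arc from x to y.  The pair is only meaningful when
   [is_digraph] holds, which [subdigraph] enforces. *)
Definition digraph (V : finType) : Type := ({set V} * {set V * V})%type.

Section Digraphs.
Local Open Scope set_scope.
Variable V : finType.
Implicit Types (G H C F : digraph V) (x y r : V).

Definition is_digraph H : bool := H.2 \subset finset.setX H.1 H.1.

Definition subdigraph H G : bool :=
  [&& is_digraph H, H.1 \subset G.1 & H.2 \subset G.2].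

Definition undirected_adj H : rel V :=
  fun x y => ((x, y) \in H.2) || ((y, x) \in H.2).

Definition weakly_connected H : bool :=
  (H.1 != finset.set0) &&
  [forall x in H.1, forall y in H.1, connect (undirected_adj H) x y].

Definition weak_component C H : bool :=
  [&& subdigraph C H, weakly_connected C &
      [forall D : digraph V,
         [&& subdigraph D H, weakly_connected D & subdigraph C D] ==> (D == C)]].

Definition weak_components H : {set digraph V} := [set C | weak_component C H].

Definition outdegree H x : nat := #|[set y | (x, y) \in H.2]|.

Definition converging_tree_to H r : bool :=
  [&& weakly_connected H, r \in H.1, outdegree H r == 0%N &
      [forall x in H.1, (x != r) ==> (outdegree H x == 1%N)]].

Definition converging_tree H : bool := [exists r, converging_tree_to H r].

Definition in_forest G F : bool :=
  [&& subdigraph F G, F.1 == G.1 &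
      [forall C : digraph V, weak_component C F ==> converging_tree C]].

Definition two_tree_in_forests G (i j : V) : {set digraph V} :=
  [set F | [&& in_forest G F, #|weak_components F| == 2%N &
    [exists Ci in weak_components F, exists Cj in weak_components F,
       [&& Ci != Cj, i \in Ci.1 & converging_tree_to Cj j]]]].

Definition spanning_trees_to G (j : V) : {set digraph V} :=
  [set F | [&& in_forest G F, #|weak_components F| == 1%N &
    [exists C in weak_components F, converging_tree_to C j]]].

Definition weight (R : realType) (w : V -> V -> R) H : R :=
  \prod_(a in H.2) w a.1 a.2.

Definition total_weight (R : realType) (w : V -> V -> R)
    (S : {set digraph V}) : R :=
  \sum_(H in S) weight w H.

End Digraphs.

Section TransitionMatrix.
Variables (R : realType) (n : nat).
Implicit Type T : 'M[R]_n.

Definition stochastic T : Prop :=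
  (forall i j, 0 <= T i j) /\ (forall i, \sum_j T i j = 1).

Definition irreducible T : Prop :=
  forall i j, exists k : nat, 0 < (T ^+ k) i j.

Definition ergodic T : Prop := stochastic T /\ irreducible T.

Definition transition_digraph T : digraph 'I_n :=
  (finset.setT, [set a : 'I_n * 'I_n | (a.1 != a.2) && (T a.1 a.2 != 0)]%SET).

Definition forest_weight T (i j : 'I_n) : R :=
  total_weight (fun x y => T x y)
    (two_tree_in_forests (transition_digraph T) i j).

Definition tree_weight T (j : 'I_n) : R :=
  total_weight (fun x y => T x y) (spanning_trees_to (transition_digraph T) j).

Definition normalized_tree_weight T (j : 'I_n) : R :=
  tree_weight T j / \sum_k tree_weight T k.

End TransitionMatrix.

Section MarkovChain.
Local Open Scope classical_set_scope.
Context (R : realType) (d : measure_display) (Omega : measurableType d).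
Variable P : probability Omega R.

(* Only meaningful when P B is nonzero; it is 0 otherwise. *)
Definition cond_prob (A B : set Omega) : R := fine (P (A `&` B)) / fine (P B).

Variable n : nat.
Implicit Type X : nat -> Omega -> 'I_n.

(* Homogeneous Markov chain with transition matrix T and arbitrary initial
   distribution. *)
Definition markov_chain X (T : 'M[R]_n) : Prop :=
  (forall p j, measurable [set w | X p w = j]) /\
  (forall (p : nat) (x : nat -> 'I_n) (j : 'I_n),
     let history := [set w | forall q, (q <= p)%N -> X q w = x q] in
     P history != 0%E ->
     cond_prob [set w | X p.+1 w = j] history = T (x p) j).

(* The minimum of {p >= 1 | X_p = j}, equal to +oo when this set is empty. *)
Definition first_passage_time X (j : 'I_n) (w : Omega) : \bar R :=
  ereal_inf [set p%:R%:E | p in [set p : nat | (1 <= p)%N /\ X p w = j]].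

Definition mean_first_passage_time X (i j : 'I_n) : \bar R :=
  (\sum_(1 <= k <oo)
     (k%:R * cond_prob [set w | first_passage_time X j w = k%:R%:E]
                       [set w | X 0%N w = i])%:E)%E.

End MarkovChain.

(* Main.v *)
Require Import Defs.
From HB Require Import structures.
From mathcomp Require Import all_boot all_order all_algebra.
From mathcomp Require Import all_classical all_reals all_analysis.
From mathcomp Require Import lra.

(** Write [f_lj] for the weight of the two-tree in-forests with [l] away from
    the root [j], so that [f_jj = 0], and [q_k] for the weight of the trees
    converging to [k].  A vector [h] of mean passage times to [j] must satisfy
    the first-step equations [h_i = 1 + \sum_(l != j) t_il h_l].  The theorem
    follows from two facts: the ratios of forest weights solve these equations,
    and a nonnegative solution is the vector of mean passage times.

    Combinatorics.  An in-forest is the same thing as a self-map [g] of the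
    vertices all of whose orbits end in a fixed point: a root is fixed, any
    other vertex goes to the head of its only arc.  For [i = j] the equation
    reads [\sum_l t_jl f_lj = \sum_(k != j) q_k] ([return_identity]): a tree
    converging to [k != j] becomes, when its arc [j -> l] is cut, a two-tree
    in-forest in which [l] is away from the root [j].  For [i != j], since the
    rows of [T] sum to [1], it reads [\sum_l t_il (f_ij - f_lj) = q_j]
    ([passage_identity]).  The left-hand side counts forests together with a
    spare arc [i -> l]; the terms with [i] and [l] in the same tree cancel.  In
    the others, exchanging the arc used at [i] with the spare arc keeps the
    weight but moves [i] to the other tree, away from the head of the new spare
    arc, which reverses the sign ([forest_exchange]); so these cancel as well,
    except that nothing can be exchanged when [i] itself is a root.  There, adding the spare arc yields each tree converging to [j]
    exactly once ([forest_attach]).  Irreducibility enters through [q_j > 0]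
    ([tree_sum_gt0]).

    Analysis.  Let [Q] be [T] with column [j] replaced by [0], and [c] the
    column [j] of [T].  By the Markov property the first passage from [i]
    happens at time [k + 1] with probability [(Q ^+ k *m c)_i]
    ([pr_first_hit]).  Summation by parts shows that a solution [h] is the sum
    of the first [N] terms of the series plus [N (Q ^+ N *m 1) + Q ^+ N *m h];
    as [1 <= h <= C] for some [C], the equation [Q *m h = h - 1] makes [Q] a
    contraction on [h] and this remainder tends to [0] ([taboo_series]). *)

Set Implicit Arguments.
Unset Strict Implicit.
Unset Printing Implicit Defensive.

Import Order.TTheory GRing.Theory Num.Theory.
Import numFieldNormedType.Exports.

Local Open Scope classical_set_scope.
Local Open Scope ring_scope.

(** * In-forests as self-maps *)

Section RootedMaps.
Variable V : finType.
Implicit Types (g : {ffun V -> V}) (x y r s i l a b : V).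

Definition rooted_at g x r : bool := (g r == r) && fconnect g x r.

(** As fixed points stand for roots, [l = i] cuts the arc out of [i]. *)
Definition redirect g i l : {ffun V -> V} :=
  [ffun x => if x == i then l else g x].

(** The covering clause alone would also admit trees converging to [b]; fixing
    [a] and [b] makes both of them roots. *)
Definition rooted_at_two a b g : bool :=
  [&& g a == a, g b == b & [forall x, rooted_at g x a || rooted_at g x b]].

Definition rooted_at_one b g : bool := [forall x, rooted_at g x b].

Lemma fconnectP g x y : reflect (exists k, y = iter k g x) (fconnect g x y).
Proof.
apply: (iffP idP) => [/iter_findex <-|[k ->]]; first by exists (findex g x y).
exact: fconnect_iter.
Qed.

Lemma iter_fixed g r k : g r = r -> iter k g r = r.
Proof. by move=> gr; elim: k => //= k ->. Qed.

Lemma rooted_at_fixed g x r : rooted_at g x r -> g r = r.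
Proof. by case/andP => /eqP. Qed.

Lemma rooted_at_self g r : g r = r -> rooted_at g r r.
Proof. by move=> gr; rewrite /rooted_at gr eqxx connect0. Qed.

Lemma rooted_at_uniq g x r s : rooted_at g x r -> rooted_at g x s -> r = s.
Proof.
move=> /andP[/eqP gr /fconnectP[k rE]] /andP[/eqP gs /fconnectP[m sE]].
by rewrite -(iter_fixed m gr) rE -iterD addnC iterD -sE (iter_fixed k gs).
Qed.

Lemma fconnect_rooted_at g x y r :
  fconnect g x y -> rooted_at g y r = rooted_at g x r.
Proof.
move=> xy; rewrite /rooted_at; case: eqP => //= gr.
apply/idP/idP => [|/fconnectP[k rE]]; first exact: connect_trans.
case/fconnectP: xy => m ->; apply/fconnectP; exists k.
by rewrite -iterD addnC iterD -rE iter_fixed.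
Qed.

Lemma rooted_at_step g x r : rooted_at g (g x) r = rooted_at g x r.
Proof. by apply: fconnect_rooted_at; apply: fconnect1. Qed.

Lemma rooted_at_fixed_point g x r : g x = x -> rooted_at g x r -> r = x.
Proof. by move=> /rooted_at_self gx xr; apply: rooted_at_uniq xr gx. Qed.

(** A vertex on a cycle returns to itself arbitrarily late, long after its orbit
    has stopped at the root. *)
Lemma rooted_at_acyclic g x r :
  rooted_at g x r -> fconnect g (g x) x -> r = x.
Proof.
move=> /andP[/eqP gr /fconnectP[k rE]] /fconnectP[m xE].
have cyc p : iter (m.+1 * p)%N g x = x.
  by elim: p => [|p IH]; rewrite ?muln0 // mulnS iterD IH iterSr.
have: (k <= m.+1 * k)%N by rewrite leq_pmull.
by move=> /subnK km; rewrite -(cyc k) -km iterD -rE iter_fixed.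
Qed.

(** An arc from [y] to [x] then closes no cycle: this is what makes redirecting
    safe. *)
Lemma rooted_at_apart g x y r s :
  rooted_at g x r -> rooted_at g y s -> r != s -> ~~ fconnect g x y.
Proof.
move=> xr ys; apply: contra => /fconnect_rooted_at xy.
by apply/eqP; apply: (rooted_at_uniq xr); rewrite -xy.
Qed.

Lemma redirect_at g i l : redirect g i l i = l.
Proof. by rewrite ffunE eqxx. Qed.

Lemma redirect_off g i l x : x != i -> redirect g i l x = g x.
Proof. by rewrite ffunE => /negPf->. Qed.

Lemma redirectK g i l m : redirect (redirect g i l) i m = redirect g i m.
Proof. by apply/ffunP => x; rewrite !ffunE; case: eqP. Qed.

Lemma redirect_id g i : redirect g i (g i) = g.
Proof. by apply/ffunP => x; rewrite ffunE; case: eqP => [->|]. Qed.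

Lemma fconnect_redirect_avoid g i l x y :
  ~~ fconnect g x i -> fconnect (redirect g i l) x y = fconnect g x y.
Proof.
move=> xi; have E k : iter k (redirect g i l) x = iter k g x.
  elim: k => //= k ->; apply: redirect_off.
  by apply: contraNneq xi => <-; apply: fconnect_iter.
by apply/fconnectP/fconnectP => -[k ->]; exists k; rewrite E.
Qed.

(** The orbit of [x] before its first visit to [i] does not see the arc out of
    [i], and redirecting that arc can be undone. *)
Lemma fconnect_redirect_at g i l x :
  fconnect (redirect g i l) x i = fconnect g x i.
Proof.
apply/idP/idP; apply: contraTT => xi; first by rewrite fconnect_redirect_avoid.
by rewrite -(redirect_id g i) -(redirectK g i l) fconnect_redirect_avoid.
Qed.

Lemma rooted_at_redirect_avoid g i l x r :
  ~~ fconnect g x i -> rooted_at (redirect g i l) x r = rooted_at g x r.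
Proof.
move=> xi; rewrite /rooted_at fconnect_redirect_avoid //.
case xr: (fconnect g x r); rewrite ?andbF // !andbT redirect_off //.
by apply: contraNneq xi => <-.
Qed.

(** Everything that used to pass through [i] now continues from [l]. *)
Lemma rooted_at_redirect g i l x r : ~~ fconnect g l i ->
  rooted_at (redirect g i l) x r =
  rooted_at g (if fconnect g x i then l else x) r.
Proof.
move=> li; case: ifPn => [xi|]; last exact: rooted_at_redirect_avoid.
rewrite -(rooted_at_redirect_avoid l r li).
rewrite -(@fconnect_rooted_at _ x i) ?fconnect_redirect_at //.
by rewrite -rooted_at_step redirect_at.
Qed.

Lemma rooted_at_twoC a b g : rooted_at_two a b g = rooted_at_two b a g.
Proof.
by rewrite /rooted_at_two andbCA; do 2!congr andb; apply: eq_forallb => x;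
  rewrite orbC.
Qed.

Lemma rooted_at_two_apart a b g x : a != b -> rooted_at_two a b g ->
  rooted_at g x a = ~~ rooted_at g x b.
Proof.
move=> ab /and3P[_ _ /forallP /(_ x)].
case xb: (rooted_at g x b) => /=; last by rewrite orbF.
by move=> _; apply: contraNF ab => /(rooted_at_uniq xb) ->.
Qed.

(** The vertices behind [i] move with it to the tree of [l], while the former
    successor of [i], which is not behind [i], stays in the tree of [k]. *)
Lemma redirect_swap j k i l g : i != k -> i != j -> k != j ->
  rooted_at_two j k g -> rooted_at g i k -> rooted_at g l j ->
  [&& rooted_at_two j k (redirect g i l), rooted_at (redirect g i l) i j
    & rooted_at (redirect g i l) (g i) k].
Proof.
move=> ik ij kj /and3P[/eqP gj /eqP gk /forallP all2] ri rl.
have li : ~~ fconnect g l i by apply: rooted_at_apart rl ri _; rewrite eq_sym.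
have gii : ~~ fconnect g (g i) i.
  by apply: contraNN ik => /(rooted_at_acyclic ri) ->.
rewrite /rooted_at_two !redirect_off 1?eq_sym // gj gk !eqxx /=.
rewrite !rooted_at_redirect // connect0 rl (negPf gii) rooted_at_step ri !andbT.
by apply/forallP => x; rewrite !rooted_at_redirect.
Qed.

(** Hanging the whole tree of the root [a] below a vertex [l] of the other tree
    leaves a single tree. *)
Lemma redirect_attach a b l g : a != b ->
  rooted_at_two a b g -> rooted_at g l b -> rooted_at_one b (redirect g a l).
Proof.
move=> ab /and3P[/eqP ga /eqP gb /forallP all2] rl.
have la : ~~ fconnect g l a.
  by apply: rooted_at_apart rl (rooted_at_self ga) _; rewrite eq_sym.
apply/forallP => x; rewrite rooted_at_redirect //; case: ifPn => // xa.
by move: (all2 x); rewrite /rooted_at (negPf xa) andbF.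
Qed.

(** Cutting the arc out of [a] undoes [redirect_attach]. *)
Lemma redirect_detach a b g : a != b -> rooted_at_one b g ->
  rooted_at_two a b (redirect g a a) && rooted_at (redirect g a a) (g a) b.
Proof.
move=> ab /forallP rb.
have gaa : ~~ fconnect g (g a) a.
  by apply: contraNN ab => /(rooted_at_acyclic (rb a)) ->.
rewrite rooted_at_redirect_avoid // rb andbT /rooted_at_two redirect_at eqxx.
rewrite redirect_off 1?eq_sym // (rooted_at_fixed (rb b)) eqxx /=.
apply/forallP => x; have [xa|xa] := boolP (fconnect g x a).
  by rewrite /rooted_at redirect_at eqxx fconnect_redirect_at xa.
by rewrite orbC (rooted_at_redirect_avoid a b xa) rb.
Qed.

Section Weights.
Variables (R : comPzRingType) (w : V -> V -> R).

Definition map_weight g : R := \prod_(x | g x != x) w x (g x).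

Definition tree_sum j : R := \sum_(g | rooted_at_one j g) map_weight g.

(** [k] is the root of the tree that contains [i]. *)
Definition forest_sum i j : R :=
  \sum_(k | k != j) \sum_(g | rooted_at_two j k g && rooted_at g i k)
    map_weight g.

Lemma map_weight_split g i :
  map_weight g = (if g i == i then 1 else w i (g i)) *
                 \prod_(x | (x != i) && (g x != x)) w x (g x).
Proof.
rewrite /map_weight; case: eqP => [gi|/eqP gi].
  rewrite mul1r; apply: eq_bigl => x; case: (x =P i) => [->|] //.
  by rewrite gi eqxx.
by rewrite (bigD1 i) //=; congr (_ * _); apply: eq_bigl => x; rewrite andbC.
Qed.

Lemma map_weight_redirect g i l : l != i ->
  map_weight (redirect g i l) =
  w i l * \prod_(x | (x != i) && (g x != x)) w x (g x).
Proof.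
move=> li; rewrite (map_weight_split _ i) redirect_at (negPf li); congr (_ * _).
rewrite (eq_bigl (fun x => (x != i) && (g x != x))).
  by apply: eq_bigr => x /andP[xi _]; rewrite redirect_off.
by move=> x; case: eqP => //= /eqP xi; rewrite redirect_off.
Qed.

(** The second component of a pair is the head of a spare arc out of [i]. *)
Let exchange i (p : {ffun V -> V} * V) := (redirect p.1 i p.2, p.1 i).

Let exchangeK i : involutive (exchange i).
Proof. by case=> g l; rewrite /exchange /= redirectK redirect_at redirect_id. Qed.

(** Since [i] is not a root, its tree is decided by its arc alone, and so the
    exchange of arcs at [i] turns one family into the other. The weight of a pair
    counts both arcs out of [i], whichever of them the forest uses. *)
Lemma forest_exchange j k i : i != k -> i != j -> k != j ->
  \sum_(p : {ffun V -> V} * V | [&& rooted_at_two j k p.1, rooted_at p.1 i k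
      & rooted_at p.1 p.2 j]) w i p.2 * map_weight p.1 =
  \sum_(p : {ffun V -> V} * V | [&& rooted_at_two j k p.1, rooted_at p.1 i j
      & rooted_at p.1 p.2 k]) w i p.2 * map_weight p.1.
Proof.
move=> ik ij kj; rewrite (reindex_inj (inv_inj (exchangeK i))) /=.
have swap g l : [&& rooted_at_two j k (redirect g i l),
    rooted_at (redirect g i l) i k & rooted_at (redirect g i l) (g i) j] =
    [&& rooted_at_two j k g, rooted_at g i j & rooted_at g l k].
  apply/idP/idP => /and3P[H1 H2 H3].
    have := redirect_swap ik ij kj H1 H2 H3.
    by rewrite redirectK redirect_id redirect_at.
  rewrite rooted_at_twoC in H1.
  by rewrite rooted_at_twoC; apply: redirect_swap; rewrite // eq_sym.
apply: eq_big => [[g l]|[g l]] /=; first exact: swap.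
rewrite swap => /and3P[_ ri rl].
have gi : g i != i.
  by apply: contraNneq ij => /rooted_at_fixed_point /(_ ri) ->.
have li : l != i.
  by apply: contraNneq kj => lE; rewrite lE in rl; rewrite (rooted_at_uniq ri rl).
rewrite map_weight_redirect // (map_weight_split g i) (negPf gi).
by rewrite mulrCA.
Qed.

(** A tree converging to [b] is recovered from the forest left after cutting the
    arc out of [a] together with the head [l] of that arc. *)
Lemma forest_attach a b : a != b ->
  \sum_(p : {ffun V -> V} * V | rooted_at_two a b p.1 && rooted_at p.1 p.2 b)
     w a p.2 * map_weight p.1 = tree_sum b.
Proof.
move=> ab; rewrite /tree_sum.
rewrite (reindex_onto (fun g => (redirect g a a, g a))
                      (fun p => redirect p.1 a p.2)) /=.
  apply: eq_big => [g|g].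
    rewrite redirectK redirect_id eqxx andbT; apply/idP/idP => [/andP[H1 H2]|].
      by have := redirect_attach ab H1 H2; rewrite redirectK redirect_id.
    exact: redirect_detach.
  rewrite redirectK redirect_id eqxx andbT => /andP[H1 H2].
  have ga : g a != a.
    apply: contraNneq ab => ga; apply/eqP; rewrite ga in H2.
    by rewrite (rooted_at_fixed_point _ H2) // redirect_at.
  rewrite [RHS](map_weight_split _ a) (negPf ga) (map_weight_split _ a).
  rewrite redirect_at eqxx mul1r; congr (_ * _).
  rewrite (eq_bigl (fun x => (x != a) && (g x != x))).
    by apply: eq_bigr => x /andP[xa _]; rewrite redirect_off.
  by move=> x; case: eqP => //= /eqP xa; rewrite redirect_off.
case=> g l /= /andP[/and3P[/eqP ga _ _] _].
by rewrite redirectK redirect_at -{2}ga redirect_id.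
Qed.

Lemma mul_forest_sum t i j :
  t * forest_sum i j = \sum_(k | k != j)
    \sum_(g | rooted_at_two j k g && rooted_at g i k) t * map_weight g.
Proof.
by rewrite /forest_sum mulr_sumr; apply: eq_bigr => k _; rewrite mulr_sumr.
Qed.

Lemma sum_pairs i (Q : {ffun V -> V} -> V -> bool) :
  \sum_l \sum_(g | Q g l) w i l * map_weight g =
  \sum_(p : {ffun V -> V} * V | Q p.1 p.2) w i p.2 * map_weight p.1.
Proof.
rewrite (exchange_big_dep predT) //= pair_big_dep /=.
by apply: eq_bigl => p.
Qed.

(** Cut the arc out of [j] in every tree that converges to another vertex. *)
Lemma return_identity j :
  \sum_l w j l * forest_sum l j = \sum_(k | k != j) tree_sum k.
Proof.
under eq_bigr do rewrite mul_forest_sum.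
rewrite exchange_big; apply: eq_bigr => k kj.
by rewrite sum_pairs -(@forest_attach j k) 1?eq_sym.
Qed.

(** Forests in which [i] and [l] share a tree cancel in the difference; the other
    ones cancel in pairs by [forest_exchange] unless [i] is the second root. *)
Lemma passage_identity i j : i != j ->
  \sum_l w i l * (forest_sum i j - forest_sum l j) = tree_sum j.
Proof.
move=> ij.
pose S k (Q : {ffun V -> V} -> V -> bool) : R :=
  \sum_(p : {ffun V -> V} * V | rooted_at_two j k p.1 && Q p.1 p.2)
     w i p.2 * map_weight p.1.
have SE (c : V -> V) : \sum_l w i l * forest_sum (c l) j =
    \sum_(k | k != j) S k (fun g l => rooted_at g (c l) k).
  rewrite (eq_bigr _ (fun l _ => mul_forest_sum (w i l) (c l) j)).
  by rewrite exchange_big; apply: eq_bigr => k _; rewrite sum_pairs.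
under eq_bigr do rewrite mulrBr.
rewrite sumrB (SE (fun=> i)) (SE id) -sumrB.
have cancel k : k != j ->
    S k (fun g l => rooted_at g i k) - S k (fun g l => rooted_at g l k) =
    S k (fun g l => rooted_at g i k && rooted_at g l j) -
    S k (fun g l => rooted_at g i j && rooted_at g l k).
  move=> kj; have jk : j != k by rewrite eq_sym.
  have apart c := rooted_at_two_apart c jk.
  have -> : S k (fun g _ => rooted_at g i k) =
      S k (fun g l => rooted_at g i k && rooted_at g l j) +
      S k (fun g l => rooted_at g i k && rooted_at g l k).
    rewrite /S (bigID (fun p => rooted_at p.1 p.2 j)) /=.
    congr (_ + _); apply: eq_bigl => -[g l] /=; first by rewrite -andbA.
    by case two: rooted_at_two => //=; rewrite (apart _ _ two) negbK.
  have -> : S k (fun g l => rooted_at g l k) =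
      S k (fun g l => rooted_at g i j && rooted_at g l k) +
      S k (fun g l => rooted_at g i k && rooted_at g l k).
    rewrite /S (bigID (fun p => rooted_at p.1 i j)) /=.
    congr (_ + _); apply: eq_bigl => -[g l] /=.
      by rewrite -andbA (andbC (rooted_at g l k)).
    case two: rooted_at_two => //=; rewrite (apart _ _ two) negbK.
    by rewrite andbC.
  by rewrite opprD addrACA subrr addr0.
rewrite (eq_bigr _ cancel) (bigD1 i) //= [X in _ + X]big1 ?addr0.
  rewrite [X in _ - X]big_pred0 ?subr0.
    rewrite -(forest_attach ij); apply: eq_bigl => -[g l] /=.
    rewrite rooted_at_twoC; case two: (rooted_at_two i j g) => //=.
    by case/and3P: two => /eqP /rooted_at_self ->.
  case=> g l /=; apply/negP => /and3P[/and3P[_ /eqP gi _] ri _].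
  by case/eqP: ij; rewrite (rooted_at_fixed_point gi ri).
move=> k /andP[kj ki]; apply/eqP; rewrite subr_eq0; apply/eqP.
by apply: forest_exchange => //; rewrite eq_sym.
Qed.
End Weights.
End RootedMaps.

(** * Weak components of in-forests *)

Section Components.
Local Open Scope set_scope.
Variable V : finType.
Implicit Types (F C D : digraph V) (g : {ffun V -> V}) (x y r : V).

(** For [F] spanning, the subdigraph induced on the undirected class of [x] is
    the weak component containing [x]. *)
Definition component F x : digraph V :=
  let cls := [set y | connect (undirected_adj F) x y] in
  (cls, F.2 :&: finset.setX cls cls).

Lemma undirected_connect_sym F : connect_sym (undirected_adj F).
Proof. by apply: sym_connect_sym => x y; rewrite /undirected_adj orbC. Qed.

Lemma undirected_connect_sub F D x y : D.2 \subset F.2 ->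
  connect (undirected_adj D) x y -> connect (undirected_adj F) x y.
Proof.
move=> /fintype.subsetP DF; apply: connect_sub => {}x {}y xy; apply: connect1.
by move: xy; rewrite /undirected_adj => /orP[] /DF ->; rewrite ?orbT.
Qed.

Lemma component_connect F x y :
  connect (undirected_adj F) x y -> component F x = component F y.
Proof.
move=> xy; rewrite /component.
have -> // : [set z | connect (undirected_adj F) x z] =
          [set z | connect (undirected_adj F) y z].
apply/finset.setP => z; rewrite !inE.
by rewrite (same_connect (undirected_connect_sym F) xy).
Qed.

Lemma component_weakly_connected F x : weakly_connected (component F x).
Proof.
have x_in : x \in (component F x).1 by rewrite inE connect0.
apply/andP; split; first by apply/set0Pn; exists x.
suff from_x y : y \in (component F x).1 ->
    connect (undirected_adj (component F x)) x y.
  apply/forall_inP => y /from_x xy; apply/forall_inP => z /from_x xz.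
  by apply: connect_trans xz; rewrite undirected_connect_sym.
rewrite inE => xy.
pose a := [pred z | connect (undirected_adj (component F x)) x z].
suff /closed_connect /(_ _ _ xy) : fingraph.closed (undirected_adj F) a.
  by rewrite !inE connect0 => <-.
apply: (intro_closed (undirected_connect_sym F)) => u v uv.
rewrite !inE => xu; apply: (connect_trans xu); apply: connect1.
have Fxu : connect (undirected_adj F) x u.
  by apply: undirected_connect_sub xu; apply: finset.subsetIl.
have Fxv := connect_trans Fxu (connect1 uv).
by move: uv; rewrite /undirected_adj !inE Fxu Fxv !andbT.
Qed.

Lemma sub_component F D x : subdigraph D F -> weakly_connected D ->
  x \in D.1 -> subdigraph D (component F x).
Proof.
move=> /and3P[dD _ D2] /andP[_ /forall_inP /(_ x) xD] x_in.
have D1 : D.1 \subset (component F x).1.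
  apply/fintype.subsetP => y y_in; rewrite inE.
  by apply: undirected_connect_sub D2 _; apply: (forall_inP (xD x_in)).
rewrite /subdigraph dD D1 finset.subsetI D2.
by apply: fintype.subset_trans dD _; apply: finset.setXS.
Qed.

Lemma weak_componentP F C : F.1 = [set: V] ->
  reflect (exists x, C = component F x) (weak_component C F).
Proof.
move=> F1.
have sub x : subdigraph (component F x) F.
  by rewrite /subdigraph /is_digraph F1 finset.subsetT finset.subsetIl
    finset.subsetIr.
apply: (iffP and3P) => [[subC wC /forallP maxC]|[x ->]].
  have [/set0Pn[x x_in] _] := andP wC; exists x.
  have /implyP := maxC (component F x).
  by rewrite sub component_weakly_connected sub_component // => /(_ isT) /eqP.
split=> //; first exact: component_weakly_connected.
apply/forallP => D; apply/implyP => /and3P[subD wD /and3P[_ le1 le2]].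
have x_in : x \in D.1 by apply: (fintype.subsetP le1); rewrite inE connect0.
have /and3P[_ ge1 ge2] := sub_component subD wD x_in.
by rewrite -pair_eqE /= !finset.eqEsubset ge1 ge2 le1 le2.
Qed.

Lemma outdegree_component F x y : connect (undirected_adj F) x y ->
  outdegree (component F x) y = outdegree F y.
Proof.
move=> xy; rewrite /outdegree; apply: eq_card => z; rewrite !inE xy /=.
case yz: ((y, z) \in F.2) => //=; apply: (connect_trans xy).
by apply: connect1; rewrite /undirected_adj yz.
Qed.

(** The digraph of a self-map: fixed points have no outgoing arc, so that the
    roots of a forest are the fixed points of the map. *)
Definition map_digraph g : digraph V :=
  ([set: V], [set a | (a.1 != a.2) && (g a.1 == a.2)]).

Definition is_forest g : bool := [forall x, [exists r, rooted_at g x r]].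

Lemma in_map_digraph g x y :
  ((x, y) \in (map_digraph g).2) = (x != y) && (g x == y).
Proof. by rewrite inE. Qed.

Lemma map_digraph_inj : injective map_digraph.
Proof.
move=> g h E; apply/ffunP => x.
have E2 y : (x != y) && (g x == y) = (x != y) && (h x == y).
  by rewrite -!in_map_digraph E.
move: (E2 (g x)) (E2 (h x)); rewrite !eqxx !andbT.
have [<-|_] := eqVneq x (g x); last by move=> /esym/andP[_ /eqP ->].
by have [|_ _ /eqP] := eqVneq x (h x).
Qed.

Lemma outdegree_map_digraph g x :
  outdegree (map_digraph g) x = (g x != x).
Proof.
rewrite /outdegree; have [gx|gx] /= := eqVneq (g x) x.
  apply: eq_card0 => y; rewrite !inE /= gx; case: eqP => //.
rewrite -(cards1 (g x)); apply: eq_card => y; rewrite !inE /= (eq_sym y).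
by case: (g x =P y) => [<-|]; rewrite ?andbF // eq_sym gx.
Qed.

Lemma rooted_at_connect g x r :
  rooted_at g x r -> connect (undirected_adj (map_digraph g)) x r.
Proof.
case/andP => _; apply: connect_sub => {r}x y /eqP xy.
have [->|x_y] := eqVneq x y; first exact: connect0.
by apply: connect1; rewrite /undirected_adj in_map_digraph x_y xy eqxx.
Qed.

(** Both ends of an arc have the same root, hence so do all the vertices of an
    undirected class. *)
Lemma connect_rooted_at g x y r :
  connect (undirected_adj (map_digraph g)) x y ->
  rooted_at g x r = rooted_at g y r.
Proof.
move=> xy; apply: (closed_connect (a := [pred x | rooted_at g x r])) xy.
move=> {}x {}y; rewrite !inE.
by case/orP; rewrite in_map_digraph => /andP[_ /eqP <-]; rewrite rooted_at_step.
Qed.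

Lemma root_component g x r :
  rooted_at g x r -> component (map_digraph g) x = component (map_digraph g) r.
Proof. by move/rooted_at_connect/component_connect. Qed.

Lemma root_component_inj g :
  {in [pred r | g r == r] &, injective (component (map_digraph g))}.
Proof.
move=> r s; rewrite !inE => /eqP gr /eqP gs E.
have : s \in (component (map_digraph g) r).1 by rewrite E inE connect0.
rewrite inE => /(connect_rooted_at s); rewrite (rooted_at_self gs) => rs.
by have := rooted_at_fixed_point gr rs.
Qed.

Lemma root_converging_tree g r :
  g r = r -> converging_tree_to (component (map_digraph g) r) r.
Proof.
move=> gr; apply/and4P; split; first exact: component_weakly_connected.
- by rewrite inE connect0.
- by rewrite outdegree_component ?connect0 // outdegree_map_digraph gr eqxx.
apply/forall_inP => y; rewrite inE => ry; apply/implyP => yr.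
rewrite outdegree_component // outdegree_map_digraph.
have := connect_rooted_at r ry; rewrite (rooted_at_self gr) => /esym yr'.
suff -> : g y != y by [].
by apply: contraNneq yr => /rooted_at_fixed_point /(_ yr') ->.
Qed.

Lemma weak_components_map g : is_forest g ->
  weak_components (map_digraph g) =
  [set component (map_digraph g) r | r in [pred r | g r == r]].
Proof.
move=> /forallP forest; apply/finset.setP => C; rewrite inE.
apply/weak_componentP/imsetP => // -[x]; last by move=> _ ->; exists x.
move=> ->; have [r xr] := existsP (forest x).
by exists r; [rewrite inE (rooted_at_fixed xr) | apply: root_component].
Qed.

Lemma card_weak_components_map g : is_forest g ->
  #|weak_components (map_digraph g)| = #|[pred r | g r == r]|.
Proof.
by move=> /weak_components_map ->; apply: card_in_imset; apply: root_component_inj.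
Qed.

Section Ambient.
Variable E : {set V * V}.
Hypothesis E_loopless : forall x, (x, x) \notin E.
Let G : digraph V := ([set: V], E).

Lemma in_forest_map g : is_forest g ->
  in_forest G (map_digraph g) = ((map_digraph g).2 \subset E).
Proof.
move=> forest; rewrite /in_forest /subdigraph /= eqxx finset.subsetT /=.
have -> : is_digraph (map_digraph g).
  by apply/fintype.subsetP => -[x y] _; rewrite !inE.
rewrite /= andbC andb_idl // => _; apply/forallP => C; apply/implyP.
have -> : weak_component C (map_digraph g) =
          (C \in weak_components (map_digraph g)) by rewrite inE.
rewrite weak_components_map // => /imsetP[r]; rewrite inE => /eqP gr ->.
by apply/existsP; exists r; apply: root_converging_tree.
Qed.

(** Out-degrees are at most one in an in-forest, so its arcs define a map. The
    orbits of that map reach the root since an undirected path to the root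
    exists and [connect_rooted_at] transports rootedness along it. *)
Lemma in_forest_is_map F :
  in_forest G F -> exists2 g, is_forest g & F = map_digraph g.
Proof.
case/and3P => /and3P[_ _ FE] /eqP F1 /forallP comps.
have tree x : exists2 r, connect (undirected_adj F) x r & outdegree F r = 0%N
    /\ forall y, connect (undirected_adj F) x y -> y != r -> outdegree F y = 1%N.
  have /implyP := comps (component F x).
  have -> : weak_component (component F x) F.
    by apply/weak_componentP => //; exists x.
  move=> /(_ isT).
  case/existsP => r /and4P[_]; rewrite inE => xr.
  rewrite outdegree_component // => /eqP r0 /forall_inP all1.
  exists r => //; split=> // y xy yr.
  have := all1 y; rewrite inE xy yr => /(_ isT) /eqP.
  by rewrite outdegree_component.
have deg1 x : (outdegree F x <= 1)%N.
  have [r _ [r0 /(_ x (connect0 _ _))]] := tree x.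
  by have [->|_ ->] := eqVneq x r; rewrite ?r0.
pose g := [ffun x => odflt x [pick y | (x, y) \in F.2]].
have FgE : F = map_digraph g.
  rewrite [F]surjective_pairing F1; congr pair; apply/finset.setP => -[x y].
  rewrite in_map_digraph ffunE; case: pickP => [z xz|no] /=; last first.
    by rewrite no andNb.
  have x_z : x != z.
    by apply: contraTneq (fintype.subsetP FE _ xz) => <-.
  apply/idP/andP => [xy|[_ /eqP <-//]].
  have yz : z = y.
    by apply: (card_le1_eqP (deg1 x)); rewrite inE.
  by rewrite -yz x_z eqxx.
exists g => //; apply/forallP => x; have [r xr [r0 _]] := tree x.
apply/existsP; exists r; rewrite FgE in xr r0.
rewrite (connect_rooted_at r xr); apply: rooted_at_self; apply/eqP.
by apply: contraPT r0; rewrite outdegree_map_digraph => ->.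
Qed.

Lemma rooted_at_two_fixed a b g : rooted_at_two a b g ->
  [pred r | g r == r] =i [set a; b].
Proof.
case/and3P => ga gb /forallP all2 x; rewrite !inE.
apply/eqP/orP => [gx|[] /eqP-> //]; try exact/eqP.
have /orP[] := all2 x => /(rooted_at_fixed_point gx) ->; rewrite eqxx; auto.
Qed.

Lemma map_two_tree g i j :
  (map_digraph g \in two_tree_in_forests G i j) =
  ((map_digraph g).2 \subset E) &&
  [exists k, [&& k != j, rooted_at_two j k g & rooted_at g i k]].
Proof.
rewrite inE; apply/and3P/andP => [[inF card2]|[gE /existsP[k /and3P[kj two ik]]]].
  case/exists_inP => Ci Ci_comp /exists_inP[Cj Cj_comp].
  case/and3P => CiCj iCi /and4P[_ jCj j0 _].
  have [h forest /map_digraph_inj gh] := in_forest_is_map inF.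
  rewrite -{h}gh in forest; split; first by rewrite -in_forest_map.
  move: Ci_comp Cj_comp; rewrite !weak_components_map //.
  case/imsetP => k; rewrite inE => /eqP gk CiE.
  case/imsetP => j'; rewrite inE => /eqP gj' CjE.
  move: jCj j0; rewrite CjE inE => j'j; rewrite outdegree_component //.
  rewrite outdegree_map_digraph => gj.
  have {}gj : g j = j by apply/eqP; apply: contraTT gj => ->.
  have jj' : j' = j.
    apply/esym/(rooted_at_fixed_point gj').
    by rewrite (connect_rooted_at _ j'j) rooted_at_self.
  move: iCi; rewrite CiE inE => ki.
  have kj : k != j by apply: contraNneq CiCj => kj; rewrite CiE CjE jj' kj.
  apply/existsP; exists k; rewrite kj -(connect_rooted_at _ ki).
  rewrite rooted_at_self // andbT /rooted_at_two gj gk !eqxx /=.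
  have fixE : [set j; k] = [set r | g r == r].
    apply/eqP; rewrite finset.eqEcard; apply/andP; split.
      by apply/fintype.subsetP => x; rewrite !inE => /orP[] /eqP ->; apply/eqP.
    move: card2; rewrite card_weak_components_map // => /eqP card2.
    by rewrite cardsE card2 cards2 (eq_sym j) kj.
  apply/forallP => x; have [r xr] := existsP (forallP forest x).
  have : r \in [set r | g r == r] by rewrite inE (rooted_at_fixed xr).
  by rewrite -fixE !inE => /orP[] /eqP <-; rewrite xr ?orbT.
have forest : is_forest g.
  apply/forallP => x; have /and3P[_ _ /forallP /(_ x) /orP[] xr] := two;
    by apply/existsP; eexists; apply: xr.
have /and3P[/eqP gj /eqP gk _] := two.
split; first by rewrite in_forest_map.
  rewrite card_weak_components_map // (eq_card (rooted_at_two_fixed two)).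
  by rewrite cards2 (eq_sym j) kj.
rewrite weak_components_map //.
apply/exists_inP; exists (component (map_digraph g) k).
  by apply: imset_f; rewrite inE gk.
apply/exists_inP; exists (component (map_digraph g) j).
  by apply: imset_f; rewrite inE gj.
rewrite root_converging_tree // andbT; apply/andP; split.
  by apply: contra kj => /eqP /root_component_inj ->; rewrite ?inE ?gk ?gj.
by rewrite inE undirected_connect_sym rooted_at_connect.
Qed.

Lemma map_spanning_tree g j :
  (map_digraph g \in spanning_trees_to G j) =
  ((map_digraph g).2 \subset E) && rooted_at_one j g.
Proof.
rewrite inE; apply/and3P/andP => [[inF card1]|[gE one]].
  case/exists_inP => C C_comp /and4P[_ jC j0 _].
  have [h forest /map_digraph_inj gh] := in_forest_is_map inF.
  rewrite -{h}gh in forest; split; first by rewrite -in_forest_map.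
  move: C_comp; rewrite !weak_components_map //.
  case/imsetP => k; rewrite inE => /eqP gk CE.
  move: jC j0; rewrite CE inE => kj; rewrite outdegree_component //.
  rewrite outdegree_map_digraph => gj.
  have {}gj : g j = j by apply/eqP; apply: contraTT gj => ->.
  apply/forallP => x; have [r xr] := existsP (forallP forest x).
  move: card1; rewrite card_weak_components_map // => /eqP card1.
  suff <- : r = j by [].
  by apply: (@card_le1_eqP _ [pred r | g r == r]);
    rewrite ?card1 ?inE ?gj ?(rooted_at_fixed xr).
have forest : is_forest g.
  by apply/forallP => x; apply/existsP; exists j; apply: (forallP one).
have gj := rooted_at_fixed (forallP one j).
split; first by rewrite in_forest_map.
  rewrite card_weak_components_map //; apply/eqP; apply: (@fintype.eq_card1 _ j) => x; rewrite !inE.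
  apply/eqP/eqP => [gx|-> //].
  by rewrite (rooted_at_fixed_point gx (forallP one x)).
rewrite weak_components_map //.
apply/exists_inP; exists (component (map_digraph g) j).
  by apply: imset_f; rewrite inE gj.
exact: root_converging_tree.
Qed.

Variables (R : realType) (w : V -> V -> R).
Hypothesis w_off : forall x y, x != y -> (x, y) \notin E -> w x y = 0.

Lemma weight_map_digraph g : weight w (map_digraph g) = map_weight w g.
Proof.
rewrite /weight /map_weight.
have -> : (map_digraph g).2 = [set (x, g x) | x in [pred x | g x != x]].
  apply/finset.setP => -[x y]; rewrite in_map_digraph.
  apply/andP/imsetP => [[xy /eqP gx]|[z]].
    by exists x; rewrite ?inE gx // eq_sym.
  by rewrite inE => gz [-> ->]; rewrite eq_sym.
by rewrite big_imset //= => x y _ _ [].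
Qed.

(** Maps that use a pair outside of [E] are harmless in the sum, as their weight
    is [0]. *)
Lemma total_weight_maps (S : {set digraph V}) (Q : pred {ffun V -> V}) :
  {in S, forall F, in_forest G F} ->
  (forall g, (map_digraph g \in S) = ((map_digraph g).2 \subset E) && Q g) ->
  total_weight w S = \sum_(g | Q g) map_weight w g.
Proof.
move=> S_forest SE; rewrite /total_weight.
have -> : S = [set map_digraph g | g in [pred g | map_digraph g \in S]].
  apply/finset.setP => F; apply/idP/imsetP => [FS|[g gS ->] //].
  have [g _ FE] := in_forest_is_map (S_forest F FS).
  by exists g; rewrite // inE -FE.
rewrite big_imset /=; last by move=> g h _ _ /map_digraph_inj.
rewrite [RHS](bigID (fun g => (map_digraph g).2 \subset E)) /=.
rewrite [X in _ + X]big1 ?addr0 => [|g /andP[_]].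
  apply: eq_big => [g|g _]; last exact: weight_map_digraph.
  by rewrite !inE SE andbC.
case/subsetPn => -[x y]; rewrite in_map_digraph => /andP[xy /eqP gx] xyE.
by rewrite /map_weight (bigD1 x) ?gx 1?eq_sym //= (w_off xy xyE) mul0r.
Qed.

Lemma total_weight_spanning_trees j :
  total_weight w (spanning_trees_to G j) = tree_sum w j.
Proof.
apply: total_weight_maps => [F|g]; last exact: map_spanning_tree.
by rewrite inE => /andP[].
Qed.

Lemma total_weight_two_tree i j :
  total_weight w (two_tree_in_forests G i j) = forest_sum w i j.
Proof.
rewrite (total_weight_maps (Q := fun g =>
  [exists k, [&& k != j, rooted_at_two j k g & rooted_at g i k]])).
- rewrite /forest_sum (exchange_big_dep predT) //= big_mkcond.
  apply: eq_bigr => g _ /=; case: ifP => [/existsP[k /and3P[kj two ik]]|/negbT/existsPn no].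
    rewrite (big_pred1 k) // => l; apply/andP/eqP => [[lj /andP[_ il]]|->].
      exact: rooted_at_uniq il ik.
    by rewrite two ik.
  rewrite big_pred0 // => k; apply/negP => /and3P[kj two ik].
  by case/negP: (no k); apply/and3P.
- by move=> F; rewrite inE => /andP[].
by move=> g; rewrite map_two_tree.
Qed.

End Ambient.
End Components.

(** * The first-step equations and their forest solution *)

Section ForestTimes.
Variables (R : realType) (n : nat) (T : 'M[R]_n).

Lemma tree_weightE j : tree_weight T j = tree_sum T j.
Proof.
apply: total_weight_spanning_trees => [x|x y xy]; rewrite inE /= ?eqxx // xy.
by move/negbNE/eqP.
Qed.

Lemma forest_weightE i j : forest_weight T i j = forest_sum T i j.
Proof.
apply: total_weight_two_tree => [x|x y xy]; rewrite inE /= ?eqxx // xy.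
by move/negbNE/eqP.
Qed.

Hypothesis T_ergodic : ergodic T.

Let T_ge0 i j : 0 <= T i j. Proof. by case: T_ergodic => -[]. Qed.
Let T_sum1 i : \sum_j T i j = 1. Proof. by case: T_ergodic => -[]. Qed.

Lemma map_weight_ge0 g : 0 <= map_weight T g.
Proof. by apply: prodr_ge0. Qed.

(** In [T ^+ k = T * T ^+ k.-1] a positive sum of nonnegative terms has a
    positive term. *)
Lemma step_closer i j k : i != j -> 0 < (T ^+ k) i j ->
  exists l m, [/\ 0 < T i l, (m < k)%N & 0 < (T ^+ m) l j].
Proof.
case: k => [|k] ij; first by rewrite expr0 mxE (negPf ij) ltxx.
have Tk_ge0 l : 0 <= (T ^+ k) l j.
  elim: k l => [|k IH] l; first by rewrite expr0 mxE ler0n.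
  by rewrite exprS -mulmxE mxE sumr_ge0 // => s _; rewrite mulr_ge0.
rewrite exprS -mulmxE mxE => pos.
have [l lpos] : exists l, 0 < T i l * (T ^+ k) l j.
  apply: contrapT => none; move: pos; rewrite big1 ?ltxx // => l _.
  apply/eqP; rewrite eq_le mulr_ge0 // andbT leNgt.
  by apply/negP => lpos; apply: none; exists l.
have il : 0 < T i l.
  by rewrite lt0r T_ge0 andbT; apply: contraTneq lpos => ->; rewrite mul0r ltxx.
by exists l, k; split=> //; rewrite -(pmulr_rgt0 _ il).
Qed.

(** Irreducibility gives every state a shortest way to [j]; the first steps of
    shortest ways make up a spanning tree. *)
Lemma tree_sum_gt0 j : 0 < tree_sum T j.
Proof.
have [_ irr] := T_ergodic.
pose dist x := ex_minn (irr x j).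
have next x : exists l, x != j -> (0 < T x l) && (dist l < dist x)%N.
  have [->|xj] := eqVneq x j; first by exists j.
  rewrite {2}/dist; case: ex_minnP => k xk _.
  have [l [m [xl mk lm]]] := step_closer xj xk.
  exists l => _; rewrite xl /dist; case: ex_minnP => d _ /(_ m lm).
  by move/leq_ltn_trans; apply.
have {next}[f f_step] := choice next.
pose g := [ffun x => if x == j then j else f x].
have gj : g j = j by rewrite ffunE eqxx.
have g_step x : x != j -> (0 < T x (g x)) && (dist (g x) < dist x)%N.
  by move=> xj; rewrite ffunE (negPf xj) f_step.
have tree : rooted_at_one j g.
  apply/forallP => x; have [k] := ubnP (dist x).
  elim: k x => // k IH x xk.
  have [->|/g_step/andP[_ gx]] := eqVneq x j; first exact: rooted_at_self.
  by rewrite -rooted_at_step IH // (leq_trans gx).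
apply: (@lt_le_trans _ _ (map_weight T g)); last first.
  rewrite /tree_sum (bigD1 g) //= lerDl.
  by apply: sumr_ge0 => h _; apply: map_weight_ge0.
apply: prodr_gt0 => x gx; suff /g_step/andP[] : x != j by [].
by apply: contraNneq gx => ->; rewrite gj.
Qed.

Lemma forest_sum_ge0 i j : 0 <= forest_sum T i j.
Proof. by apply: sumr_ge0 => k _; apply: sumr_ge0 => g _; apply: map_weight_ge0. Qed.

Lemma forest_sum_root j : forest_sum T j j = 0.
Proof.
apply: big1 => k kj; apply: big_pred0 => g; apply/negP.
case/andP => /and3P[/eqP gj _ _] /(rooted_at_fixed_point gj) kE.
by rewrite kE eqxx in kj.
Qed.

(** The claimed mean passage time from [i] to [j]; the first case is the inverse
    of the normalized tree weight. *)
Definition forest_time j i : R :=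
  if i == j then (\sum_k tree_sum T k) / tree_sum T j
  else forest_sum T i j / tree_sum T j.

Lemma forest_time_ge0 j i : 0 <= forest_time j i.
Proof.
rewrite /forest_time; case: ifP => _; apply: divr_ge0; rewrite ?forest_sum_ge0 //;
  rewrite ?(ltW (tree_sum_gt0 _)) //.
by apply: sumr_ge0 => k _; apply: ltW; apply: tree_sum_gt0.
Qed.

(** The first-step equation: [return_identity] when [i = j], [passage_identity]
    combined with the row sums of [T] otherwise. *)
Lemma forest_time_step j i :
  forest_time j i = 1 + \sum_(l | l != j) T i l * forest_time j l.
Proof.
have qj : tree_sum T j != 0 by rewrite gt_eqF // tree_sum_gt0.
have -> : \sum_(l | l != j) T i l * forest_time j l =
    (\sum_l T i l * forest_sum T l j) / tree_sum T j.
  rewrite [in RHS](bigD1 j) //= forest_sum_root mulr0 add0r mulr_suml.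
  by apply: eq_bigr => l /negPf lj; rewrite /forest_time lj mulrA.
rewrite -{1}(divff qj) -mulrDl /forest_time; case: eqVneq => [->|ij].
  by rewrite return_identity [in LHS](bigD1 j).
congr (_ / _); rewrite -(passage_identity _ ij).
under [X in X + _]eq_bigr do rewrite mulrBr.
by rewrite sumrB -mulr_suml T_sum1 mul1r subrK.
Qed.

End ForestTimes.

(** * Summing the taboo series *)

Section TabooSeries.
Variable R : realType.

(** Each of the first [N + 1] terms of the geometric series is at least [s ^+ N]. *)
Lemma mulrn_expr_le (s : R) N : 0 <= s < 1 -> N.+1%:R * s ^+ N <= (1 - s)^-1.
Proof.
case/andP => s0 s1; have d0 : 0 < 1 - s by rewrite subr_gt0.
rewrite -[leRHS]mul1r ler_pdivlMr //.
apply: (@le_trans _ _ ((1 - s) * \sum_(k < N.+1) s ^+ k)); last first.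
  by rewrite -opprB mulNr -subrX1 opprB lerBlDr lerDl exprn_ge0.
rewrite mulrC ler_pM2l // mulr_natl -[N.+1 in leLHS]card_ord -sumr_const.
apply: ler_sum => k _; apply: ler_wiXn2l => //; first exact: ltW.
by rewrite -ltnS.
Qed.

(** For [s] between [sqrt r] and [1], [N.+1%:R * r ^+ N] is at most
    [(N.+1%:R * s ^+ N) * s ^+ N], where the first factor is bounded. *)
Lemma cvg_mulrn_expr (t r : R) : 0 <= t -> 0 <= r < 1 ->
  (fun N => t * (N.+1%:R * r ^+ N)) @ \oo --> (0 : R).
Proof.
(* by the AM-GM inequality, r <= s * s *)
move=> t0 /andP[r0 r1]; pose s := (1 + r) / 2.
have s0 : 0 <= s by rewrite /s; lra.
have s1 : s < 1 by rewrite /s; lra.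
have rs : r <= s * s by rewrite /s; nra.
apply: (@squeeze_cvgr _ _ _ _ (fun=> 0) (geometric (t / (1 - s)) s)).
- apply: nearW => N; apply/andP; split.
    by rewrite mulr_ge0 // mulr_ge0 ?exprn_ge0.
  rewrite /= -mulrA ler_wpM2l //.
  apply: (@le_trans _ _ (N.+1%:R * s ^+ N * s ^+ N)).
    by rewrite -mulrA ler_wpM2l // -exprMn lerXn2r // nnegrE mulr_ge0.
  by rewrite ler_wpM2r ?exprn_ge0 // mulrn_expr_le // s0 s1.
- exact: cvg_cst.
by apply: cvg_geometric; rewrite ger0_norm.
Qed.

Variables (n : nat) (Q : 'M[R]_n) (h : 'cV[R]_n).
Hypothesis Q_ge0 : forall i l, 0 <= Q i l.
Hypothesis h_step : h = const_mx 1 + Q *m h.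
Hypothesis h_ge0 : forall i, 0 <= h i 0.

Let one : 'cV[R]_n := const_mx 1.
Let c := one - Q *m one.

(** Summation by parts: [Q ^+ k *m c] is the decrease of the survival
    probabilities [Q ^+ k *m one]. *)
Lemma taboo_partial_sum N :
  h = \sum_(k < N) (Q ^+ k *m c) *+ k.+1 + (Q ^+ N *m one) *+ N + Q ^+ N *m h.
Proof.
elim: N => [|N IH].
  by rewrite big_ord0 mulr0n !add0r expr0 mul1mx.
rewrite {1}IH big_ord_recr /= -!addrA; congr (_ + _).
rewrite {1}h_step mulmxDr -/one mulmxA -[Q ^+ N *m Q]/(Q ^+ N * Q) -exprSr.
rewrite /c mulmxBr mulmxA -[Q ^+ N *m Q]/(Q ^+ N * Q) -exprSr mulrnBl.
by rewrite !addrA subrK -mulrSr.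
Qed.

Lemma taboo_power_one_le N i : 0 <= (Q ^+ N *m one) i 0 <= (Q ^+ N *m h) i 0.
Proof.
elim: N i => [|N IH] i.
  rewrite expr0 !mul1mx [h]h_step !mxE ler01 lerDl.
  by apply: sumr_ge0 => l _; rewrite mulr_ge0.
rewrite exprS -!mulmxA ![(Q *m _) i 0]mxE; apply/andP; split.
  by apply: sumr_ge0 => l _; rewrite mulr_ge0 //; case/andP: (IH l).
by apply: ler_sum => l _; rewrite ler_wpM2l //; case/andP: (IH l).
Qed.

(** The solution [h] bounded by [C] is at least [1], hence
    [Q *m h = h - 1 <= (1 - 1 / C) h]. *)
Lemma taboo_contraction C N i : (forall l, h l 0 <= C) -> 1 <= C ->
  (Q ^+ N *m h) i 0 <= (1 - C^-1) ^+ N * h i 0.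
Proof.
move=> hC C1; have C0 : 0 < C by apply: lt_le_trans C1.
have r0 : 0 <= 1 - C^-1 by rewrite subr_ge0 invf_le1.
elim: N i => [|N IH] i; first by rewrite !expr0 mul1mx mul1r.
rewrite exprS -mulmxA mxE.
apply: (@le_trans _ _ ((1 - C^-1) ^+ N * (Q *m h) i 0)).
  rewrite mxE mulr_sumr; apply: ler_sum => l _.
  by rewrite mulrCA ler_wpM2l.
rewrite exprSr -mulrA ler_wpM2l ?exprn_ge0 // mulrBl mul1r mulrC.
have hE : h i 0 = 1 + (Q *m h) i 0 by rewrite {1}h_step 2!mxE.
have : h i 0 / C <= 1 by rewrite ler_pdivrMr // mul1r.
by move: hE; set u := (Q *m h) i 0; lra.
Qed.

Lemma taboo_series i :
  (fun N => \sum_(k < N) k.+1%:R * (Q ^+ k *m c) i 0) @ \oo --> h i 0.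
Proof.
have h_ge1 l : 1 <= h l 0.
  by have := taboo_power_one_le 0 l; rewrite expr0 !mul1mx mxE => /andP[].
pose C := \sum_l h l 0.
have hC l : h l 0 <= C.
  by rewrite /C (bigD1 l) //= lerDl; apply: sumr_ge0.
have C1 : 1 <= C by apply: le_trans (hC i).
have C0 : 0 < C by apply: lt_le_trans C1.
pose r := 1 - C^-1.
have r01 : 0 <= r < 1 by rewrite subr_ge0 invf_le1 // C1 ltrBlDr ltrDl invr_gt0.
apply: (@squeeze_cvgr _ _ _ _ (fun N => h i 0 - h i 0 * (N.+1%:R * r ^+ N))
  (fun=> h i 0)).
- apply: nearW => N.
  have hE : h i 0 = \sum_(k < N) k.+1%:R * (Q ^+ k *m c) i 0 +
      (Q ^+ N *m one) i 0 *+ N + (Q ^+ N *m h) i 0.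
    rewrite {1}(taboo_partial_sum N) 2!mxE summxE mulmxnE.
    by congr (_ + _ + _); apply: eq_bigr => k _; rewrite mulmxnE mulr_natl.
  have /andP[u0 uh] := taboo_power_one_le N i.
  have uN := taboo_contraction N i hC C1.
  move: hE u0 uh uN; set S := \sum_(k < N) _; set u := (_ *m one) i 0.
  set v := (_ *m h) i 0; rewrite -/r => hE u0 uh uN.
  have v0 : 0 <= v by apply: le_trans uh.
  have uvN : u *+ N + v <= h i 0 * (N.+1%:R * r ^+ N).
    apply: (@le_trans _ _ (v *+ N.+1)).
      by rewrite mulrSr lerD2r lerMn2r uh orbT.
    by rewrite mulrCA mulr_natl lerMn2r mulrC uN orbT.
  have : 0 <= u *+ N by apply: mulrn_wge0.
  move: hE uvN; set U := u *+ N; set t := h i 0 * _ => hE uvN U0.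
  by apply/andP; split; lra.
- rewrite -[X in _ --> X]subr0; apply: cvgB; first exact: cvg_cst.
  by apply: cvg_mulrn_expr => //; apply: le_trans (h_ge1 i).
exact: cvg_cst.
Qed.

End TabooSeries.

(** * First passage of the chain *)

Section Passage.
Context (R : realType) (d : measure_display) (Omega : measurableType d).
Variables (P : probability Omega R) (n : nat) (T : 'M[R]_n).
Variable X : nat -> Omega -> 'I_n.
Hypothesis X_chain : markov_chain P X T.

Let pr (A : set Omega) : R := fine (P A).

Definition history (x : nat -> 'I_n) p : set Omega :=
  [set w | forall q, (q <= p)%N -> X q w = x q].

Definition first_hit j p k : set Omega :=
  [set w | X (p + k).+1 w = j /\
           forall q, (p < q <= p + k)%N -> X q w <> j].

Let X_measurable p j : measurable [set w | X p w = j].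
Proof. by case: X_chain. Qed.

Lemma history_measurable x p : measurable (history x p).
Proof.
rewrite (_ : history x p = \bigcap_(q in [set q | (q <= p)%N])
  [set w | X q w = x q]); last by apply/seteqP; split.
exact: bigcap_measurableType.
Qed.

Lemma first_hit_measurable j p k : measurable (first_hit j p k).
Proof.
rewrite (_ : first_hit j p k = [set w | X (p + k).+1 w = j] `&`
  \bigcap_(q in [set q | (p < q <= p + k)%N]) ~` [set w | X q w = j]).
  by apply: measurableI => //; apply: bigcap_measurableType => q _;
    apply: measurableC.
by apply/seteqP; split.
Qed.

Lemma pr_partition p (A : set Omega) : measurable A ->
  pr A = \sum_l pr (A `&` [set w | X p w = l]).
Proof.
move=> mA; rewrite /pr sum_fine; last first.
  by move=> l _; apply: fin_num_measure; apply: measurableI.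
rewrite -(@measure_bigsetU_ord _ _ _ P n xpredT); last 2 first.
- by move=> l; apply: measurableI.
- by move=> l m _ _ [w [[_ /= <-] [_ /= <-]]].
congr (fine (P _)); apply/seteqP; split=> [w Aw|].
  by rewrite (bigD1 (X p w)) //=; left.
by apply: (big_ind (fun B => B `<=` A)) => // B C BA CA w [/BA|/CA].
Qed.

(** The Markov property, extended to null histories where both sides vanish. *)
Lemma pr_step x p l :
  pr ([set w | X p.+1 w = l] `&` history x p) = pr (history x p) * T (x p) l.
Proof.
have mH := history_measurable x p.
have [H0|H0] := eqVneq (P (history x p)) 0%E.
  rewrite /pr H0 mul0r (_ : P (_ `&` _) = 0%E) //.
  by apply: subset_measure0 H0; [apply: measurableI| |apply: subIsetr].
have [_ /(_ p x l H0) <-] := X_chain.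
rewrite /cond_prob -/(pr _) -/(pr _) mulrC divfK //.
by rewrite /pr fine_eq0 // fin_num_measure.
Qed.

Lemma first_hit0 j p : first_hit j p 0 = [set w | X p.+1 w = j].
Proof.
rewrite /first_hit addn0; apply/seteqP; split=> [w []|w Xw] //=.
by split=> // q; rewrite ltnNge; case: leqP.
Qed.

(** Once the state at time [p + 1] is known, it joins the history and the first
    passage is one step closer. *)
Lemma history_extend x p l j k : l != j ->
  (first_hit j p k.+1 `&` history x p) `&` [set w | X p.+1 w = l] =
  first_hit j p.+1 k `&` history (fun q => if (q <= p)%N then x q else l) p.+1.
Proof.
move=> lj; apply/seteqP; split=> w /=.
  case=> -[[Xj avoid] hist] Xl; split.
    split; first by rewrite addSnnS.
    by move=> q /andP[pq qk]; apply: avoid; rewrite addnS -addSn qk (ltnW pq).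
  move=> q; case: (leqP q p) => [qp _|pq qp]; first exact: hist.
  by rewrite (_ : q = p.+1) //; apply/eqP; rewrite eqn_leq qp pq.
case=> -[Xj avoid] hist.
have Xl : X p.+1 w = l by rewrite hist // ltnn.
split=> //; split; last first.
  by move=> q qp; rewrite hist ?qp // leqW.
split; first by rewrite -addSnnS.
move=> q /andP[pq qk]; have [->|qp] := eqVneq q p.+1.
  by rewrite Xl; apply/eqP.
by apply: avoid; rewrite addSnnS qk ltn_neqAle eq_sym qp pq.
Qed.

(** Transitions of the chain killed when it enters [j]. *)
Definition taboo j : 'M[R]_n := \matrix_(i, l) (if l == j then 0 else T i l).

(** Induction on [k], splitting on the state at time [p + 1]. The history is a
    whole trajectory because the Markov property is given for those only; it
    grows by one state at each step. *)
Lemma pr_first_hit j k x p :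
  pr (first_hit j p k `&` history x p) =
  pr (history x p) * (taboo j ^+ k *m col j T) (x p) 0.
Proof.
elim: k x p => [|k IH] x p.
  by rewrite first_hit0 pr_step expr0 mul1mx mxE.
rewrite (@pr_partition p.+1); last first.
  by apply: measurableI; [apply: first_hit_measurable|apply: history_measurable].
rewrite exprS -mulmxA mxE mulr_sumr; apply: eq_bigr => l _; rewrite mxE.
case: eqVneq => [->|lj].
  rewrite mul0r mulr0 (_ : _ `&` _ = set0) ?/pr ?measure0 //.
  apply/seteqP; split=> // w /= [[[_ avoid] _]]; apply: avoid.
  by rewrite ltnSn addnS ltnS leq_addr.
rewrite history_extend // IH ltnn mulrA; congr (_ * _).
rewrite -pr_step; congr (pr _); apply/seteqP; split=> w /=.
  by move=> hist; split=> [|q qp]; rewrite hist ?ltnn // ?qp // leqW.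
case=> Xl hist q; case: (leqP q p) => [qp _|pq qp]; first exact: hist.
by rewrite (_ : q = p.+1) //; apply/eqP; rewrite eqn_leq qp pq.
Qed.

Lemma first_passage_timeE j k :
  [set w | first_passage_time R X j w = k.+1%:R%:E] = first_hit j 0 k.
Proof.
have hit m w : first_hit j 0 m w -> first_passage_time R X j w = m.+1%:R%:E.
  case=> Xj avoid; apply/eqP; rewrite eq_le; apply/andP; split.
    by apply: ereal_inf_lbound; exists m.+1.
  apply: le_ereal_inf_tmp => _ [q [q1 Xq] <-]; rewrite lee_fin ler_nat ltnNge.
  by apply/negP => qm; apply: (avoid q) => //; rewrite add0n q1.
apply/seteqP; split=> w /=; last exact: hit.
move=> wk; have [m Xm] : exists m, X m.+1 w == j.
  apply: contrapT => none; move: wk; rewrite /first_passage_time.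
  rewrite (_ : image _ _ = set0) ?ereal_inf0 //.
  apply/seteqP; split=> // t [[|m] [/= m1 Xm] _] //.
  by apply: none; exists m; apply/eqP.
case: (ex_minnP (ex_intro (fun m => X m.+1 w == j) m Xm)) => {Xm}m /eqP Xm m_min.
have hm : first_hit j 0 m w.
  split=> // -[|q] // /andP[_ qm] /eqP/m_min; rewrite add0n in qm.
  by rewrite leqNgt qm.
move: wk; rewrite (hit _ _ hm) => -[] /eqP; rewrite eqr_nat => /eqP[<-].
exact: hm.
Qed.

Lemma cond_prob_first_passage i j k : P [set w | X 0%N w = i] != 0%E ->
  cond_prob P [set w | first_passage_time R X j w = k.+1%:R%:E]
    [set w | X 0%N w = i] = (taboo j ^+ k *m col j T) i 0.
Proof.
move=> Pi; have Hi : [set w | X 0%N w = i] = history (fun=> i) 0.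
  apply/seteqP; split=> w /=; last by apply.
  by move=> Xi q; rewrite leqn0 => /eqP ->.
rewrite /cond_prob first_passage_timeE Hi.
have := pr_first_hit j k (fun=> i) 0; rewrite /pr => ->.
rewrite mulrAC divff ?mul1r //.
by rewrite /pr fine_eq0 -?Hi // fin_num_measure.
Qed.

Hypothesis T_ergodic : ergodic T.

Lemma forest_time_series j i :
  (fun N => \sum_(k < N) k.+1%:R * (taboo j ^+ k *m col j T) i 0) @ \oo
    --> forest_time T j i.
Proof.
have T_ge0 x y : 0 <= T x y by case: T_ergodic => -[].
pose h : 'cV[R]_n := \col_x forest_time T j x.
have taboo_mul (v : 'cV[R]_n) x :
    (taboo j *m v) x 0 = \sum_(l | l != j) T x l * v l 0.
  rewrite mxE [RHS]big_mkcond; apply: eq_bigr => l _; rewrite mxE.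
  by case: eqP; rewrite ?mul0r.
have -> : col j T = const_mx 1 - taboo j *m const_mx 1.
  apply/colP => x; rewrite [RHS]mxE [X in _ = _ + X]mxE taboo_mul !mxE.
  have [[_ /(_ x) T1] _] := T_ergodic; rewrite -[X in _ = X - _]T1 (bigD1 j) //=.
  rewrite [X in _ - X](eq_bigr (T x)) ?addrK // => l _.
  by rewrite mxE mulr1.
have := @taboo_series R n (taboo j) h _ _ _ i; rewrite mxE; apply.
- by move=> x l; rewrite mxE; case: ifP.
- apply/colP => x; rewrite [RHS]mxE taboo_mul !mxE forest_time_step //.
  by congr (_ + _); apply: eq_bigr => l _; rewrite mxE.
by move=> x; rewrite mxE forest_time_ge0.
Qed.

End Passage.

(** * Mean first passage times as ratios of forest weights *)

Theorem theorem1 (R : realType) (n : nat) (T : 'M[R]_n)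
  (T_ergodic : ergodic T)
  (d : measure_display) (Omega : measurableType d) (P : probability Omega R)
  (X : nat -> Omega -> 'I_n) (X_chain : markov_chain P X T)
  (i j : 'I_n) (X0_i : P [set w | X 0%N w = i] != 0%E) :
  mean_first_passage_time P X i j =
  (if i == j then 1 / normalized_tree_weight T j
   else forest_weight T i j / tree_weight T j)%:E.
Proof.
have -> : (if i == j then 1 / normalized_tree_weight T j
    else forest_weight T i j / tree_weight T j) = forest_time T j i.
  rewrite /forest_time /normalized_tree_weight forest_weightE tree_weightE.
  under eq_bigr do rewrite tree_weightE.
  by rewrite div1r invf_div.
apply/cvg_lim => //; rewrite -cvg_shiftS /=.
apply: cvg_EFin.
  by apply: nearW => N; rewrite sumEFin.
rewrite [X in X @ _](_ : _ = fun N => \sum_(k < N)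
    k.+1%:R * (taboo T j ^+ k *m col j T) i 0); first exact: forest_time_series.
apply/funext => N /=; rewrite sumEFin /= big_add1 /= big_mkord.
by apply: eq_bigr => k _; rewrite (cond_prob_first_passage X_chain).
Qed.
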